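(* Let $k\geq 3$ and let $T$ be a $k$-tree with weighting function $\mathbf{w}:V(T)\cup E(T)\to\mathbb{C}$ such that $\mathbf{w}(e)\neq 0$ for every $e\in E(T)$. If $\lambda\in\mathbb{C}$ satisfies $\lambda\neq\mathbf{w}(v)$ for every $v\in V(T)$, then $\lambda$ is an eigenvalue of $\mathcal{A}(T,\mathbf{w})$ if and only if there exists a subtree $T'$ of $T$ such that $(T',\mathbf{w})$ (with $\mathbf{w}$ restricted to $V(T')\cup E(T')$) is consistently $\lambda$-normal.
   Context: A $k$-graph $H$ consists of a finite vertex set $V(H)$ and a set $E(H)$ of $k$-element subsets of $V(H)$; $E_H(v)$ is the set of edges containing $v$. A walk is a sequence $v_0e_1v_1\ldots e_\ell v_\ell$ with $v_{i-1},v_i\in e_i$; it is a cycle if no vertices or edges are repeated except $v_0=v_\ell$. A $k$-tree is a connected $k$-graph with no cycle; a subtree of $T$ is a $k$-graph $T'$ with $V(T')\subseteq V(T)$, $E(T')\subseteq E(T)$ that is itself a $k$-tree. For $V(H)=\{v_1,\dots,v_n\}$, the adjacency tensor $\mathcal{A}(H,\mathbf{w})=(a_{i_1\cdots i_k})$ has $a_{i\cdots i}=\mathbf{w}(v_i)$, $a_{i_1\cdots i_k}=\mathbf{w}(e)/(k-1)!$ if $\{v_{i_1},\dots,v_{i_k}\}=e\in E(H)$, and $0$ otherwise; $\lambda$ is an eigenvalue if there is nonzero $\mathbf{x}\in\mathbb{C}^n$ with $\sum_{i_2,\dots,i_k}a_{ii_2\cdots i_k}\mathbf{x}_{i_2}\cdots\mathbf{x}_{i_k}=\lambda\mathbf{x}_i^{k-1}$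 for all $i$. A weighted incidence matrix of $(H,\mathbf{w})$ is a complex matrix $B$ with rows indexed by $V(H)$ and columns by $E(H)$ such that $B(v,e)\neq 0$ iff $v\in e$. For $\lambda\neq\mathbf{w}(v)$ for all $v$ lying in edges, $(H,\mathbf{w})$ is $\lambda$-normal if some weighted incidence matrix $B$ satisfies (C1) $\sum_{e\in E_H(v)}B(v,e)=1$ for every $v\in V(H)$ and (C2) $\prod_{v\in e}B(v,e)=\prod_{v\in e}\frac{\mathbf{w}(e)}{\lambda-\mathbf{w}(v)}$ for every $e\in E(H)$; it is consistently $\lambda$-normal if moreover (C3) for every cycle $v_0e_1v_1\ldots e_\ell v_\ell(=v_0)$ of $H$, $\prod_{i=1}^{\ell}\frac{B(v_i,e_i)(\lambda-\mathbf{w}(v_i))}{B(v_{i-1},e_i)(\lambda-\mathbf{w}(v_{i-1}))}=1$. *)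

(* Defs.v *)
From HB Require Import structures.
From mathcomp Require Import all_boot all_order all_algebra.
From mathcomp Require Import complex reals.

Set Implicit Arguments.
Unset Strict Implicit.
Unset Printing Implicit Defensive.

Import Order.TTheory GRing.Theory Num.Theory.
Local Open Scope ring_scope.

(* The vertex set is a subset of an ambient finite type, so that a graph and
   its subgraphs have the same type. *)
Record kgraph (U : finType) (k : nat) := KGraph {
  verts : {set U};
  edges : {set {set U}};
  edges_verts : forall e, e \in edges -> e \subset verts;
  edges_card : forall e, e \in edges -> #|e| = k
}.

(* The walk v_0 e_1 v_1 ... e_l v_l is encoded by functions on nat, whose
   values past l are irrelevant; e i stands for e_(i+1), which joins v i to
   v i.+1. *)
Definition is_walk (U : finType) (k : nat) (H : kgraph U k)
    (l : nat) (v : nat -> U) (e : nat -> {set U}) : Prop :=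
  (forall i, (i <= l)%N -> v i \in verts H) /\
  (forall i, (i < l)%N -> [/\ e i \in edges H, v i \in e i & v i.+1 \in e i]).

(* The bound 2 <= l rules out the degenerate closed walks v_0 and
   v_0 e_1 v_0, which exist in every graph with an edge. *)
Definition is_cycle (U : finType) (k : nat) (H : kgraph U k)
    (l : nat) (v : nat -> U) (e : nat -> {set U}) : Prop :=
  [/\ is_walk H l v e,
      (2 <= l)%N,
      v l = v 0%N,
      (forall i j, (i < l)%N -> (j < l)%N -> v i = v j -> i = j) &
      (forall i j, (i < l)%N -> (j < l)%N -> e i = e j -> i = j)].

(* The graph without vertices is not connected. *)
Definition connected (U : finType) (k : nat) (H : kgraph U k) : Prop :=
  verts H != set0 /\
  forall x y, x \in verts H -> y \in verts H ->
    exists l v e, [/\ is_walk H l v e, v 0%N = x & v l = y].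

Definition ktree (U : finType) (k : nat) (H : kgraph U k) : Prop :=
  connected H /\ forall l v e, ~ is_cycle H l v e.

Definition subtree (U : finType) (k : nat) (T' T : kgraph U k) : Prop :=
  [/\ verts T' \subset verts T, edges T' \subset edges T & ktree T'].

(* Tensors of order r.+1 and dimension n. *)
Definition tensor (C : Type) (r n : nat) := r.+1.-tuple 'I_n -> C.

Definition tensor_eigenvalue (C : fieldType) (r n : nat)
    (A : tensor C r n) (lam : C) : Prop :=
  exists2 x : 'cV[C]_n, x != 0 &
    forall i : 'I_n,
      \sum_(t : r.-tuple 'I_n) A [tuple of i :: t] * \prod_(j <- t) x j 0
      = lam * x i 0 ^+ r.

(* A weighting assigns w (inl v) to the vertex v and w (inr e) to the edge e;
   only its values on the vertices and edges of the graph at hand matter, so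
   restriction to a subgraph is implicit. *)
Definition weighting (C : Type) (U : finType) := (U + {set U})%type -> C.

(* The vertices are numbered by enum_val : 'I_#|verts H| -> U, and the order
   k is written k.-1.+1. *)
Definition adjacency_tensor (C : fieldType) (U : finType) (k : nat)
    (H : kgraph U k) (w : weighting C U) : tensor C k.-1 #|verts H| :=
  fun t =>
    let e := [set enum_val i | i in t] in
    if constant t then w (inl (enum_val (thead t)))
    else if e \in edges H then w (inr e) / (k.-1)`!%:R
    else 0.
Arguments adjacency_tensor {C U k} H w t.

Definition weighted_incidence (C : fieldType) (U : finType) (k : nat)
    (H : kgraph U k) (B : U -> {set U} -> C) : Prop :=
  forall v e, v \in verts H -> e \in edges H -> (B v e != 0) = (v \in e).

Definition normal_C1 (C : fieldType) (U : finType) (k : nat)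
    (H : kgraph U k) (B : U -> {set U} -> C) : Prop :=
  forall v, v \in verts H -> \sum_(e in edges H | v \in e) B v e = 1.

Definition normal_C2 (C : fieldType) (U : finType) (k : nat)
    (H : kgraph U k) (w : weighting C U) (lam : C)
    (B : U -> {set U} -> C) : Prop :=
  forall e, e \in edges H ->
    \prod_(v in e) B v e = \prod_(v in e) (w (inr e) / (lam - w (inl v))).

Definition normal_C3 (C : fieldType) (U : finType) (k : nat)
    (H : kgraph U k) (w : weighting C U) (lam : C)
    (B : U -> {set U} -> C) : Prop :=
  forall l v e, is_cycle H l v e ->
    \prod_(i < l) ((B (v i.+1) (e i) * (lam - w (inl (v i.+1))))
                 / (B (v i) (e i) * (lam - w (inl (v i))))) = 1.

Definition consistently_normal (C : fieldType) (U : finType) (k : nat)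
    (H : kgraph U k) (w : weighting C U) (lam : C) : Prop :=
  (forall v e, e \in edges H -> v \in e -> lam != w (inl v)) /\
  exists B : U -> {set U} -> C,
    [/\ weighted_incidence H B, normal_C1 H B, normal_C2 H w lam B
      & normal_C3 H w lam B].

(* Main.v *)
Require Import Defs.
From HB Require Import structures.
From mathcomp Require Import all_boot all_order all_algebra.
From mathcomp Require Import complex reals.
From mathcomp Require Import zify ring.

(* Multiplying the eigenequation at v by x_v turns it into
     (lam - w v) x_v^k = \sum_(e containing v) w e x^e,   x^e = \prod_(u in e) x_u,
   so on a set of vertices where x does not vanish
     B(v, e) = w e x^e / ((lam - w v) x_v^k)
   satisfies (C1) and (C2), while (C3) is void on a tree.  For a subtree T' take
   a connected subgraph inside the support of x that is saturated under adding
   edges of T: the other edges of T at a vertex of T' carry a zero of x.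
   Conversely, x is recovered from B edge by edge, by k-th roots, and extended
   by 0 outside T'.  An edge of T that is not in T' meets T' in at most one
   vertex, since otherwise a shortest walk in T' would close up to a cycle;
   hence, as k >= 3, in every eigenequation it contributes a product containing
   a zero of x.  The same fact shows that an edge added to a connected partial
   solution has exactly one vertex whose value is already prescribed. *)

Set Implicit Arguments.
Unset Strict Implicit.
Unset Printing Implicit Defensive.

Import Order.TTheory GRing.Theory Num.Theory.
Local Open Scope ring_scope.
Local Open Scope complex_scope.

(** * Walks, shortcuts and cycles in subgraphs *)

Definition subgraph (U : finType) (k : nat) (H G : kgraph U k) : Prop :=
  verts H \subset verts G /\ edges H \subset edges G.

Lemma is_walk_sub (U : finType) (k : nat) (H G : kgraph U k) l v e :
  subgraph H G -> is_walk H l v e -> is_walk G l v e.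
Proof.
move=> [/subsetP sV /subsetP sE] [wV wE]; split=> i il; first exact/sV/wV.
by have [/sE] := wE i il.
Qed.

Lemma is_cycle_sub (U : finType) (k : nat) (H G : kgraph U k) l v e :
  subgraph H G -> is_cycle H l v e -> is_cycle G l v e.
Proof. by move=> sHG [wH *]; split=> //; exact: is_walk_sub sHG wH. Qed.

(* The hypothesis covers both a repeated vertex [v i = v j] and a repeated edge
   [e i = e j]. *)
Lemma walk_shortcut (U : finType) (k : nat) (H : kgraph U k) l v e i j :
  is_walk H l v e -> (i < j <= l)%N ->
  (if (j < l)%N then v i \in e j else v i == v l) ->
  exists v' e', [/\ is_walk H (l - (j - i)) v' e',
                    v' 0%N = v 0%N & v' (l - (j - i))%N = v l].
Proof.
move=> [wV wE] /andP[ij jl] hij.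
(* The vertices from [v i.+1] to [v j] are dropped. If [j < l], the edge [e j] leads directly from
   [v i] to [v j.+1]; if [j = l], the walk ends at [v i]. *)
exists (fun m => if (m <= i)%N then v m else v (m + (j - i))%N).
exists (fun m => if (m < i)%N then e m else e (m + (j - i))%N).
split=> //; last first.
  case: leqP => h; last by congr (v _); lia.
  move: hij; case: ltnP => [|_ /eqP<-]; first lia.
  congr (v _); lia.
split=> m ml.
  case: ifP => _; apply: wV; lia.
have [mi|mi|mi] := ltngtP m i.
- apply: wE; lia.
- rewrite addSn; apply: wE; lia.
- rewrite {}mi in ml *; rewrite addSn subnKC ?(ltnW ij) //.
  have jl' : (j < l)%N by lia.
  by move: hij; rewrite jl'; have [? ? ?] := wE j jl'.
Qed.

(* A shortest walk between two vertices of [f] inside [H] is closed by [f]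
   into a cycle. *)
Lemma acyclic_edge_meet (U : finType) (k : nat) (G H : kgraph U k) f x y :
  (forall l v e, ~ is_cycle G l v e) -> connected H -> subgraph H G ->
  f \in edges G -> f \notin edges H ->
  x \in f -> y \in f -> x \in verts H -> y \in verts H -> x = y.
Proof.
move=> acG [_ cH] sHG fG fH xf yf xH yH; apply/eqP/negPn/negP => xy.
have [l [v [e [wH v0 vl]]]] := cH _ _ xH yH.
elim/ltn_ind: l v e wH v0 vl => l IH v e wH v0 vl.
(* Strong induction on the length makes the walk shortest: any shortcut contradicts the induction
   hypothesis. *)
have short i j : (i < j <= l)%N ->
    (if (j < l)%N then v i \in e j else v i == v l) -> False.
  move=> ijl hij; have [v' [e' [w' v'0 v'l]]] := walk_shortcut wH ijl hij.
  apply: (IH _ _ v' e' w'); [lia | by rewrite v'0 | by rewrite v'l].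
have wE := wH.2.
have vinj i j : (i < j <= l)%N -> v i <> v j.
  move=> ijl vij; apply: (short _ _ ijl); case: ifP => [jl|jl].
    by rewrite vij; have [] := wE j jl.
  by rewrite vij; apply/eqP; congr (v _); lia.
have einj i j : (i < j < l)%N -> e i <> e j.
  move=> /andP[ij jl] eij; apply: (short i j); first lia.
  by rewrite jl -eij; have [] := wE i (ltn_trans ij jl).
have l0 : (0 < l)%N.
  by rewrite lt0n; apply: contraNneq xy => l0; rewrite -v0 -vl l0.
(* The cycle is the walk followed by [f], which leads from [v l = y] back to [x]. It has length at
   least 2 by [l0], and [f] repeats no edge because it is not in [H]. *)
apply: (acG l.+1 (fun i => if (i <= l)%N then v i else x)
                (fun i => if (i < l)%N then e i else f)).
have [wV' wE'] := is_walk_sub sHG wH.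
split=> //.
- split=> i il.
    case: ifP => [/wV' //|_]; exact: (subsetP sHG.1).
  rewrite (il : (i <= l)%N); case: ltnP => [/wE' //|li].
  by have -> : i = l; [lia | rewrite vl].
- by rewrite ltnn.
- move=> i j il jl; rewrite (il : (i <= l)%N) (jl : (j <= l)%N) => vij.
  case: (ltngtP i j) => // h; [case: (@vinj i j) | case: (@vinj j i)] => //; lia.
- move=> i j il jl; case: ltnP => hi; case: ltnP => hj eij.
  + case: (ltngtP i j) => // h; [case: (@einj i j) | case: (@einj j i)] => //; lia.
  + by move: fH; rewrite -eij; have [->] := wE i hi.
  + by move: fH; rewrite eij; have [->] := wE j hj.
  + lia.
Qed.

(** * Connectedness as reachability *)

Definition adj (U : finType) (k : nat) (H : kgraph U k) : rel U :=
  fun x y => [exists e in edges H, (x \in e) && (y \in e)].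

Lemma adj_sym (U : finType) (k : nat) (H : kgraph U k) : symmetric (adj H).
Proof. by move=> x y; apply: eq_existsb => e; rewrite [(x \in e) && _]andbC. Qed.

Lemma walk_connect (U : finType) (k : nat) (H : kgraph U k) l v e :
  is_walk H l v e -> connect (adj H) (v 0%N) (v l).
Proof.
elim: l => [|l IH] [wV wE]; first exact: connect0.
apply: connect_trans (_ : connect _ _ (v l)) _.
  by apply: IH; split=> i il; [apply: wV | apply: wE]; lia.
have [eH ve ve'] := wE l (ltnSn l).
by apply/connect1/existsP; exists (e l); rewrite eH ve.
Qed.

Lemma connect_walk (U : finType) (k : nat) (H : kgraph U k) x y :
  x \in verts H -> connect (adj H) x y ->
  exists l v e, [/\ is_walk H l v e, v 0%N = x & v l = y].
Proof.
move=> xH /connectP[p + ->]; elim: p x xH => [|z p IH] x xH /=.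
  by move=> _; exists 0%N, (fun=> x), (fun=> set0); split; [split=> // |..].
move=> /andP[/existsP[f /and3P[fH xf zf]] pz].
have zH : z \in verts H by apply: (subsetP (edges_verts fH)).
have [l [v [e [[wV wE] v0 vl]]]] := IH z zH pz.
exists l.+1, (fun i => if i is j.+1 then v j else x),
  (fun i => if i is j.+1 then e j else f); split=> //.
split=> -[|i] //= il; [exact: wV | by rewrite v0 | exact: wE].
Qed.

(** With [connect], transitivity and symmetry stand in for concatenating and reversing walks. *)
Lemma connectedE (U : finType) (k : nat) (H : kgraph U k) :
  connected H <-> verts H != set0 /\
    {in verts H &, forall x y, connect (adj H) x y}.
Proof.
split=> -[H0 cH]; split=> // x y xH yH; last exact: connect_walk (cH _ _ xH yH).
by have [l [v [e [wH <- <-]]]] := cH _ _ xH yH; exact: walk_connect wH.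
Qed.

(** * Growing a connected subgraph edge by edge *)

Lemma vertex_graph_edges_verts (U : finType) (x : U) (e : {set U}) :
  e \in set0 -> e \subset [set x].
Proof. by rewrite inE. Qed.

Lemma vertex_graph_edges_card (U : finType) (k : nat) (e : {set U}) :
  e \in set0 -> #|e| = k.
Proof. by rewrite inE. Qed.

Definition vertex_graph (U : finType) (k : nat) (x : U) : kgraph U k :=
  KGraph (@vertex_graph_edges_verts U x) (@vertex_graph_edges_card U k).

Lemma vertex_graph_connected (U : finType) (k : nat) (x : U) :
  connected (vertex_graph k x).
Proof.
apply/connectedE; split=> [|y z /set1P-> /set1P->]; last exact: connect0.
by apply/set0Pn; exists x; rewrite inE.
Qed.

Lemma add_edge_edges_verts (U : finType) (k : nat) (H : kgraph U k) (f e : {set U}) :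
  e \in f |: edges H -> e \subset verts H :|: f.
Proof.
case/setU1P=> [->|/edges_verts eH]; first exact: subsetUr.
exact: subset_trans eH (subsetUl _ _).
Qed.

Lemma add_edge_edges_card (U : finType) (k : nat) (H : kgraph U k) (f e : {set U}) :
  #|f| = k -> e \in f |: edges H -> #|e| = k.
Proof. by move=> fk /setU1P[->//|/edges_card]. Qed.

Definition add_edge (U : finType) (k : nat) (H : kgraph U k) (f : {set U})
    (fk : #|f| = k) : kgraph U k :=
  KGraph (@add_edge_edges_verts U k H f)
         (fun e => @add_edge_edges_card U k H f e fk).

(** All vertices are reachable from the shared vertex [p]: the old ones inside [H], the new ones
    through [f]. *)
Lemma add_edge_connected (U : finType) (k : nat) (H : kgraph U k) (f : {set U})
    (fk : #|f| = k) p :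
  connected H -> p \in verts H -> p \in f -> connected (add_edge H fk).
Proof.
move=> /connectedE[H0 cH] pH pf; apply/connectedE; split.
  by apply/set0Pn; exists p; rewrite inE pH.
have cp x : x \in verts H :|: f -> connect (adj (add_edge H fk)) p x.
  case/setUP=> [xH|xf].
    apply: connect_sub (cH _ _ pH xH) => y z /existsP[e /andP[eH yz]].
    by apply/connect1/existsP; exists e; rewrite inE eH orbT.
  by apply/connect1/existsP; exists f; rewrite setU11 pf.
move=> x y /cp px /cp; apply: connect_trans.
by rewrite (same_connect_r (sym_connect_sym (@adj_sym _ _ _)) px) connect0.
Qed.

(** Adding edges of [D] that touch the current graph must stop, since fewer sets remain outside its
    edge set each time. The invariant [P] carries connectedness together with whatever is being
    constructed. *)
Lemma edge_saturation (U : finType) (k : nat) (D : {set {set U}})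
    (P : kgraph U k -> Prop) (H0 : kgraph U k) :
  P H0 -> (forall e, e \in D -> #|e| = k) ->
  (forall H (e : {set U}) p (ek : #|e| = k), P H -> e \in D -> e \notin edges H ->
     p \in e -> p \in verts H -> P (add_edge H ek)) ->
  exists2 H, P H &
    forall (e : {set U}) p, e \in D -> p \in e -> p \in verts H -> e \in edges H.
Proof.
move=> PH0 Dk step.
have [n] := ubnP #|~: edges H0|; elim: n H0 PH0 => // n IH H PH Hn.
case: (pickP [pred e in D | (e \notin edges H) && ~~ [disjoint e & verts H]]).
  move=> e /= /and3P[eD eH /pred0Pn[p /andP[pe pH]]].
  apply: (IH (add_edge H (Dk e eD))); first exact: step pe pH.
  apply: leq_trans (Hn : (_ <= n)%N); apply/proper_card.
  rewrite properEneq setCS subsetUr andbT.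
  by apply: contraNneq eH => /setC_inj <-; exact: setU11.
move=> no; exists H => // e p eD pe pH; apply: contraFT (no e) => eH /=.
by rewrite eD eH; apply/pred0Pn; exists p; rewrite /= pe.
Qed.

(** Along a path of [G] that starts in [H], each edge meets [H], hence belongs to [H] and brings the
    next vertex into it. *)
Lemma saturated_subgraph (U : finType) (k : nat) (G H : kgraph U k) :
  connected G -> connected H -> subgraph H G ->
  (forall (e : {set U}) p, e \in edges G -> p \in e -> p \in verts H -> e \in edges H) ->
  verts G \subset verts H.
Proof.
move=> /connectedE[_ cG] [/set0Pn[x xH] _] [sV _] sat; apply/subsetP => y yG.
have /connectP[p + ->] := cG _ _ (subsetP sV _ xH) yG.
elim: p x xH => //= z p IH x xH /andP[/existsP[f /and3P[fG xf zf]]].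
by apply: IH; apply: (subsetP (edges_verts (sat _ _ fG xf xH))).
Qed.

(** * The tensor eigenequation as a sum over edges *)

Lemma uniq_all_perm_enum (I : finType) (A : {set I}) (t : seq I) :
  uniq t -> all [in A] t -> size t = #|A| -> perm_eq t (enum A).
Proof.
move=> Ut tA st; apply: uniq_perm (enum_uniq _) _ => //.
have sub : {subset t <= enum A} by move=> x /(allP tA); rewrite mem_enum.
by have [] := uniq_min_size Ut sub _; rewrite -?cardE ?st.
Qed.

Lemma tuple_edgeE (I U : finType) (f : I -> U) (r : nat) (i : I) (t : r.-tuple I)
    (e : {set U}) :
  injective f -> #|e| = r.+1 -> f i \in e ->
  ([set f j | j in i :: t] == e) =
  all [in [set j | f j \in e :\ f i]] t && uniq t.
Proof.
move=> f_inj er ie; apply/eqP/andP => [de | [/allP tA Ut]].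
  have cs : #|i :: t| = size (i :: t).
    by rewrite -(card_imset _ f_inj) de er /= size_tuple.
  have /andP[it Ut] : uniq (i :: t) by apply/card_uniqP.
  split=> //; apply/allP => j jt; rewrite !inE -de.
  rewrite (inj_eq f_inj) imset_f ?inE ?jt ?orbT // andbT.
  by apply: contraNneq it => <-.
apply/eqP; rewrite eqEcard er card_imset //.
have /card_uniqP-> /= : uniq (i :: t).
  by rewrite /= Ut andbT; apply/negP => /tA; rewrite !inE eqxx.
rewrite size_tuple leqnn andbT; apply/subsetP => _ /imsetP[j + ->].
by rewrite inE => /predU1P[->//|/tA]; rewrite !inE => /andP[].
Qed.

(* There are [r!] orderings of [e :\ f i], which cancels the normalisation of
   the adjacency tensor. *)
Lemma sum_tuple_edge (C : numFieldType) (I U : finType) (f : I -> U) (r : nat)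
    (i : I) (e : {set U}) (X : U -> C) (c : C) :
  injective f -> #|e| = r.+1 -> e \subset codom f -> f i \in e ->
  \sum_(t : r.-tuple I | [set f j | j in i :: t] == e)
    (c / r`!%:R * \prod_(j <- t) X (f j)) = c * \prod_(u in e :\ f i) X u.
Proof.
move=> f_inj er /subsetP sef ie; set A := [set j | f j \in e :\ f i].
have fA : [set f j | j in A] = e :\ f i.
  apply/setP => u; apply/imsetP/idP => [[j + ->]|ue]; first by rewrite inE.
  have /codomP[j uj] : u \in codom f by apply: sef; move/setD1P: ue => [].
  by exists j => //; rewrite inE -uj.
have Ar : #|A| = r.
  by rewrite -(card_imset _ f_inj) fA; move: er; rewrite (cardsD1 (f i)) ie => -[].
rewrite (eq_bigl _ _ (fun t => tuple_edgeE t f_inj er ie)).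
rewrite [LHS](eq_bigr (fun=> c / r`!%:R * \prod_(u in e :\ f i) X u)); last first.
  move=> t /andP[tA Ut]; congr (_ * _).
  rewrite -fA big_imset /=; last exact: in2W.
  rewrite -big_enum; apply/perm_big/uniq_all_perm_enum => //.
  by rewrite size_tuple.
rewrite sumr_const.
have -> : #|[pred t : r.-tuple I | all [in A] t && uniq t]| = r`!.
  transitivity (#|[set t : r.-tuple I | all [in A] t & uniq t]|).
    by apply: eq_card => t; rewrite !inE.
  by rewrite card_uniq_tuples Ar ffactnn.
rewrite -[LHS]mulr_natr mulrAC divfK // pnatr_eq0 -lt0n; exact: fact_gt0.
Qed.

(** The constant tuple gives the diagonal term; it is no edge, because [k >= 2]. The other nonzero
    terms are grouped by the edge that the tuple enumerates. *)
Lemma adjacency_tensor_sum (C : numFieldType) (U : finType) (k : nat)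
    (H : kgraph U k) (w : weighting C U) (X : U -> C) (i : 'I_#|verts H|) :
  (2 <= k)%N ->
  \sum_(t : k.-1.-tuple 'I_#|verts H|)
     adjacency_tensor H w [tuple of i :: t] * \prod_(j <- t) X (enum_val j)
  = w (inl (enum_val i)) * X (enum_val i) ^+ k.-1
    + \sum_(e in edges H | enum_val i \in e)
        w (inr e) * \prod_(u in e :\ enum_val i) X u.
Proof.
move=> k2; have f_inj : injective (@enum_val _ (mem (verts H))) by apply: enum_val_inj.
have const_set (t : k.-1.-tuple 'I_#|verts H|) : constant (i :: t) ->
    [set enum_val j | j in i :: t] = [set enum_val i].
  move=> ct; apply/setP => u; rewrite inE; apply/imsetP/eqP => [[j + ->]|->].
    by rewrite inE => /predU1P[->//|/(allP ct)/eqP->].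
  by exists i; rewrite ?inE ?eqxx.
have not_edge u : [set u] \notin edges H.
  by apply/negP => /edges_card; rewrite cards1 => k1; move: k2; rewrite -k1.
rewrite (bigID (fun t : k.-1.-tuple 'I_#|verts H| => constant (i :: t))) /=.
congr (_ + _).
  rewrite (big_pred1 [tuple of nseq k.-1 i]) => [|t].
    rewrite /adjacency_tensor /= all_pred1_nseq theadE; congr (_ * _).
    by rewrite big_nseq -Monoid.iteropE.
  rewrite /= -val_eqE /=; apply/idP/eqP => [/all_pred1P->|->].
    by rewrite size_tuple.
  exact: all_pred1_nseq.
rewrite (bigID (fun t : k.-1.-tuple 'I_#|verts H| =>
   [set enum_val j | j in i :: t] \in edges H)) /= addrC big1 ?add0r; last first.
  by move=> t /andP[/negbTE ct /negbTE te]; rewrite /adjacency_tensor /= ct te mul0r.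
rewrite (partition_big (fun t : k.-1.-tuple 'I_#|verts H| =>
   [set enum_val j | j in i :: t])
   (fun e => (e \in edges H) && (enum_val i \in e))) /=; last first.
  by move=> t /andP[_ ->]; rewrite imset_f ?inE ?eqxx.
apply: eq_bigr => e /andP[eH ie].
rewrite -(@sum_tuple_edge _ _ _ _ k.-1 i e X (w (inr e)) f_inj) //; first last.
- apply/subsetP => u /(subsetP (edges_verts eH)) uH; apply/codomP.
  by exists (enum_rank_in uH u); rewrite enum_rankK_in.
- by rewrite (edges_card eH) prednK //; exact: ltnW.
apply: eq_big => [t|t /andP[/andP[/negbTE ct te] /eqP de]].
  case: eqP => [de|]; rewrite ?andbF // de eH !andbT.
  by apply/negP => ct; have := not_edge (enum_val i); rewrite -(const_set t) // de eH.
by rewrite /adjacency_tensor /= ct de eH.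
Qed.

(** An eigenvector indexed by vertices instead of their numbers, with the diagonal term moved to the
    left. *)
Definition eigenfunction (C : fieldType) (U : finType) (k : nat)
    (H : kgraph U k) (w : weighting C U) (lam : C) (X : U -> C) : Prop :=
  (exists2 v, v \in verts H & X v != 0) /\
  forall v, v \in verts H ->
    (lam - w (inl v)) * X v ^+ k.-1 =
    \sum_(e in edges H | v \in e) w (inr e) * \prod_(u in e :\ v) X u.

Lemma tensor_eigenvalueP (C : numFieldType) (U : finType) (k : nat)
    (H : kgraph U k) (w : weighting C U) (lam : C) :
  (2 <= k)%N ->
  tensor_eigenvalue (adjacency_tensor H w) lam <->
  exists X, eigenfunction H w lam X.
Proof.
move=> k2.
have eqE (X : U -> C) i :
    \sum_(t : k.-1.-tuple 'I_#|verts H|)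
       adjacency_tensor H w [tuple of i :: t] * \prod_(j <- t) X (enum_val j)
      = lam * X (enum_val i) ^+ k.-1 <->
    (lam - w (inl (enum_val i))) * X (enum_val i) ^+ k.-1 =
    \sum_(e in edges H | enum_val i \in e)
      w (inr e) * \prod_(u in e :\ enum_val i) X u.
  rewrite adjacency_tensor_sum // mulrBl; split=> [<-|<-].
    by rewrite addrAC subrr add0r.
  by rewrite addrC subrK.
split=> [[x x0 xE] | [X [[v vH Xv] XE]]].
  (* The sum has at most one term, so this extends [x] by 0 outside [verts H]. *)
  pose X u := \sum_(i | enum_val i == u) x i 0.
  have Xx i : X (enum_val i) = x i 0.
    rewrite /X (eq_bigl (pred1 i)) ?big_pred1_eq // => j.
    by rewrite (inj_eq enum_val_inj).
  exists X; split.
    have /rV0Pn[i xi] : x^T != 0 by rewrite trmx_eq0.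
    by exists (enum_val i); rewrite ?enum_valP // Xx; rewrite mxE in xi.
  move=> v vH; rewrite -(enum_rankK_in vH vH); apply/eqE.
  rewrite Xx -xE; apply: eq_bigr => t _; congr (_ * _).
  by apply: eq_bigr => j _; exact: Xx.
exists (\col_i X (enum_val i)).
  apply: contraNneq Xv => /matrixP/(_ (enum_rank_in vH v) 0).
  by rewrite !mxE enum_rankK_in // => ->.
move=> i; rewrite mxE -(eqE X i).2; last exact/XE/enum_valP.
by apply: eq_bigr => t _; congr (_ * _); apply: eq_bigr => j _; rewrite mxE.
Qed.

(** * From an eigenvector to a normal subtree *)

Lemma eigenfunction_normal (C : fieldType) (U : finType) (k : nat)
    (T : kgraph U k) (w : weighting C U) (lam : C) (X : U -> C) :
  (0 < k)%N -> ktree T ->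
  (forall e, e \in edges T -> w (inr e) != 0) ->
  (forall v, v \in verts T -> lam != w (inl v)) ->
  eigenfunction T w lam X ->
  exists T', subtree T' T /\ consistently_normal T' w lam.
Proof.
move=> k0 [cT aT] hw hlam [[v0 v0T Xv0] XE].
(* [S] is the support of [X] and [D] the edges inside it; saturation yields a connected component of
   this subgraph. *)
pose S := [set v in verts T | X v != 0].
pose D := [set e in edges T | e \subset S].
have [|||T' [cT' sS sE] sat] := @edge_saturation U k D
  (fun H => [/\ connected H, verts H \subset S & edges H \subset edges T])
  (vertex_graph k v0).
- split; [exact: vertex_graph_connected | | exact: sub0set].
  by apply/subsetP => x /set1P->; rewrite inE v0T.
- by move=> e; rewrite inE => /andP[/edges_card].
- move=> H e p ek [cH sS sE]; rewrite inE => /andP[eT eS] _ pe pH.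
  split; first exact: add_edge_connected pe.
    by rewrite subUset sS.
  by rewrite subUset sub1set eT.
have sT : subgraph T' T.
  by split=> //; apply/subsetP => v /(subsetP sS); rewrite inE => /andP[].
have acT' l v e : ~ is_cycle T' l v e by move/(is_cycle_sub sT)/aT.
have XT' v : v \in verts T' -> X v != 0.
  by move/(subsetP sS); rewrite inE => /andP[].
have lamT' v : v \in verts T' -> lam - w (inl v) != 0.
  by rewrite subr_eq0 => /(subsetP sT.1)/hlam.
have eV (e : {set U}) v : e \in edges T' -> v \in e -> v \in verts T'.
  by move/edges_verts/subsetP; apply.
exists T'; split; first by case: sT.
split=> [v e eT' ve|]; first exact/hlam/(subsetP sT.1)/(eV e).
pose Y (e : {set U}) := w (inr e) * \prod_(u in e) X u.
have Y0 e : e \in edges T' -> Y e != 0.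
  move=> eT'; rewrite mulf_neq0 //; first exact/hw/(subsetP sE).
  by apply/prodf_neq0 => u /(eV e)-/(_ eT')/XT'.
pose d v := (lam - w (inl v)) * X v ^+ k.
have d0 v : v \in verts T' -> d v != 0.
  by move=> vT'; rewrite mulf_neq0 ?expf_neq0 ?lamT' ?XT'.
exists (fun v (e : {set U}) => if v \in e then Y e / d v else 0); split.
- move=> v e vT' eT'; case: ifP => _; last by rewrite eqxx.
  by rewrite mulf_neq0 ?invr_eq0 ?Y0 ?d0.
- move=> v vT'.
  rewrite (eq_bigr (fun e => Y e / d v)) => [|e /andP[_ ->] //].
  rewrite -mulr_suml; apply: (canLR (mulfK (d0 v vT'))); rewrite mul1r.
  (* Splitting one factor [X v] off [d v] exposes the left side of the eigenequation at [v]. *)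
  rewrite /d -{2}(prednK k0) exprSr mulrA XE ?(subsetP sT.1) // mulr_suml.
  rewrite [RHS](bigID (mem (edges T'))) /= [X in _ = _ + X]big1 ?addr0.
    apply: eq_big => [e|e /andP[_ ve]]; last first.
      by rewrite /Y (big_setD1 v) //= -mulrA [X v * _]mulrC.
    case: (boolP (e \in edges T')) => [/(subsetP sE)->|];
      by rewrite ?andbT ?andbF.
  move=> e /andP[/andP[eT ve] eT'].
  (* An edge at [v] inside the support would have been added by saturation, so [e] has a vertex [u]
     with [X u = 0], and [u] differs from [v]. *)
  have /subsetPn[u ue uS] : ~~ (e \subset S).
    by apply: contra eT' => eS; apply: (sat e v) => //; rewrite inE eT.
  have Xu : X u = 0.
    move: uS; rewrite inE negb_and negbK => /orP[|/eqP//].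
    by rewrite (subsetP (edges_verts eT)).
  rewrite (big_setD1 u) /= ?Xu ?mul0r ?mulr0 ?mul0r // !inE ue andbT.
  by apply: contra_eq_neq Xu => ->; exact: XT'.
- move=> e eT'.
  (* The second factors multiply to 1: [e] has [k] vertices, so both numerator and denominator
     become the [k]-th power of the product of [X] over [e]. *)
  rewrite (eq_bigr (fun v => (w (inr e) / (lam - w (inl v))) *
                             ((\prod_(u in e) X u) * (X v ^+ k)^-1))); last first.
    by move=> v ve; rewrite ve /Y /d invfM; ring.
  rewrite big_split /= [X in _ * X]big_split /= prodr_const.
  rewrite (edges_card (subsetP sE _ eT')).
  rewrite prodfV prodrXl divff ?mulr1 // expf_neq0 //.
  by apply/prodf_neq0 => u /(eV e)-/(_ eT')/XT'.
- by move=> l v e /acT'.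
Qed.

(** * From an incidence matrix to an eigenvector *)

(** The formula expressing [B] through [X], cleared of denominators. It is a condition on each edge
    separately, so it can be met one edge at a time. *)
Definition edge_solution (C : fieldType) (U : finType) (k : nat)
    (H : kgraph U k) (w : weighting C U) (lam : C)
    (B : U -> {set U} -> C) (X : U -> C) : Prop :=
  {in verts H, forall v, X v != 0} /\
  forall v (e : {set U}), e \in edges H -> v \in e ->
    X v ^+ k * ((lam - w (inl v)) * B v e) = w (inr e) * \prod_(u in e) X u.

(* The values on [e] are [k]-th roots; the product over [e] comes out right up
   to a [k]-th root of unity [z], which is absorbed at one new vertex [a]. *)
Lemma edge_solution_add (C : numClosedFieldType) (U : finType) (k : nat)
    (H : kgraph U k) (w : weighting C U) (lam : C) (B : U -> {set U} -> C)
    (X : U -> C) (e : {set U}) (ek : #|e| = k) p :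
  (2 <= k)%N -> e :&: verts H = [set p] ->
  w (inr e) != 0 ->
  (forall v, v \in e -> lam - w (inl v) != 0) ->
  (forall v, v \in e -> B v e != 0) ->
  \prod_(v in e) B v e = \prod_(v in e) (w (inr e) / (lam - w (inl v))) ->
  edge_solution H w lam B X ->
  exists X', edge_solution (add_edge H ek) w lam B X'.
Proof.
move=> k2 eH we lame Be C2 [X0 XE].
have k0 : (0 < k)%N by exact: ltnW.
have /setIP[pe pH] : p \in e :&: verts H by rewrite eH set11.
have nH u : u \in e -> (u \in verts H) = (u == p).
  by move=> ue; rewrite -in_set1 -eH inE ue.
pose b v := (lam - w (inl v)) * B v e.
have b0 v : v \in e -> b v != 0 by move=> ve; rewrite mulf_neq0 ?lame ?Be.
pose c := X p ^+ k * b p.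
have c0 : c != 0 by rewrite mulf_neq0 ?expf_neq0 ?X0 ?b0.
(* The left side of the edge relation must be the same at all vertices of [e]; its value [c] is
   prescribed at [p]. *)
pose y u := if u \in verts H then X u else k.-root (c / b u).
have yE u : u \in e -> y u ^+ k * b u = c.
  move=> ue; rewrite /y nH //; case: eqP => [->//|_].
  by rewrite rootCK // divfK ?b0.
have y0 u : u \in e -> y u != 0.
  move=> /yE yc; apply: contraNneq c0 => yu0.
  by rewrite -yc yu0 expr0n eqn0Ngt k0 mul0r.
pose Y := w (inr e) * \prod_(u in e) y u.
have Y0 : Y != 0 by rewrite mulf_neq0 //; apply/prodf_neq0.
(* Multiply [yE] over the [k] vertices of [e]; by (C2) the product of the [b u] is
   [w (inr e) ^+ k]. *)
have YE : Y ^+ k = c ^+ k.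
  rewrite -{2}ek -prodr_const -(eq_bigr _ yE) big_split /= prodrXl.
  rewrite big_split /= C2 big_split /= prodfV prodr_const ek.
  rewrite [X in _ * X]mulrC divfK ?exprMn 1?mulrC //.
  by apply/prodf_neq0 => v /lame.
pose z := c / Y.
have zk : z ^+ k = 1 by rewrite expr_div_n YE divff ?expf_neq0.
have z0 : z != 0 by rewrite mulf_neq0 ?invr_eq0.
have [a /setD1P[ap ae]] : exists a, a \in e :\ p.
  by apply/set0Pn; rewrite -card_gt0; move: k2; rewrite -ek (cardsD1 p) pe.
have aH : a \notin verts H by rewrite nH.
pose s u := if u == a then z else 1.
have sH u : u \in verts H -> s u = 1.
  by rewrite /s; case: eqP => // -> /(negP aH).
have sk u : s u ^+ k = 1 by rewrite /s; case: ifP; rewrite ?expr1n.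
have s0 u : s u != 0 by rewrite /s; case: ifP; rewrite ?oner_eq0.
have sprod : \prod_(u in e) s u = z.
  rewrite (big_setD1 a) //= [s a]/s eqxx big1 ?mulr1 // => u /setD1P[/negbTE ua _].
  by rewrite /s ua.
have XH u : u \in verts H -> y u * s u = X u.
  by move=> uH; rewrite sH // mulr1 /y uH.
exists (fun u => y u * s u); split.
  by move=> u /setUP[uH|ue]; [rewrite XH ?X0 | rewrite mulf_neq0 ?y0].
move=> v f /setU1P[-> ve|fH vf].
  by rewrite exprMn sk mulr1 yE // big_split /= sprod mulrA -/Y mulrC divfK.
have fV := subsetP (edges_verts fH).
rewrite XH ?fV // XE //; congr (_ * _).
by apply: eq_bigr => u uf; rewrite XH ?fV.
Qed.

(** Saturation starts from one vertex with value 1. Each added edge meets the current graph in [p]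
    alone, by acyclicity, and connectedness of [T] makes the final graph exhaust [T]. *)
Lemma normal_edge_solution (C : numClosedFieldType) (U : finType) (k : nat)
    (T : kgraph U k) (w : weighting C U) (lam : C) (B : U -> {set U} -> C) :
  (2 <= k)%N -> ktree T ->
  (forall e, e \in edges T -> w (inr e) != 0) ->
  (forall v, v \in verts T -> lam != w (inl v)) ->
  weighted_incidence T B -> normal_C2 T w lam B ->
  exists X, edge_solution T w lam B X.
Proof.
move=> k2 [cT aT] hw hlam Binc C2.
have [/set0Pn[r rT] _] := cT.
have [|||H [cH sH [X [X0 XE]]] sat] := @edge_saturation U k (edges T)
  (fun H => [/\ connected H, subgraph H T & exists X, edge_solution H w lam B X])
  (vertex_graph k r).
- split; first exact: vertex_graph_connected.
    by split; rewrite ?sub0set ?sub1set.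
  by exists (fun=> 1); split=> [v _|v e]; rewrite ?oner_eq0 // inE.
- exact: edges_card.
- move=> H e p ek [cH sH [X XS]] eT eH pe pH.
  have eV := subsetP (edges_verts eT).
  split; first exact: add_edge_connected pe.
    by case: sH => sV sE; split; rewrite subUset ?sV ?sub1set ?edges_verts ?eT.
  apply: (@edge_solution_add _ _ _ H w lam B X e ek p) => //.
  + apply/setP => u; rewrite !inE; apply/andP/eqP => [[ue uH]|->//].
    exact: acyclic_edge_meet aT cH sH eT eH ue pe uH pH.
  + exact: hw.
  + by move=> v ve; rewrite subr_eq0 hlam ?eV.
  + by move=> v ve; rewrite Binc ?eV.
  + exact: C2.
have /subsetP sV := saturated_subgraph cT cH sH sat.
exists X; split=> [v /sV/X0//|v e eT ve].
by apply: (XE _ _ (sat _ _ eT ve (sV _ _)) ve); exact: subsetP (edges_verts eT) _ ve.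
Qed.

Lemma normal_eigenfunction (C : numClosedFieldType) (U : finType) (k : nat)
    (T T' : kgraph U k) (w : weighting C U) (lam : C) :
  (3 <= k)%N -> ktree T ->
  (forall e, e \in edges T -> w (inr e) != 0) ->
  (forall v, v \in verts T -> lam != w (inl v)) ->
  subtree T' T -> consistently_normal T' w lam ->
  exists X, eigenfunction T w lam X.
Proof.
move=> k3 [_ aT] hw hlam [sV sE tT'] [_ [B [Binc C1 C2 _]]].
have [X [X0 XE]] : exists X, edge_solution T' w lam B X.
  apply: normal_edge_solution => //; first exact: ltnW.
    by move=> e /(subsetP sE)/hw.
  by move=> v /(subsetP sV)/hlam.
have k0 : (0 < k)%N by lia.
have [cT' _] := tT'.
have meet (e : {set U}) x y : e \in edges T -> e \notin edges T' ->
    x \in e -> y \in e -> x \in verts T' -> y \in verts T' -> x = y.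
  exact: acyclic_edge_meet aT cT' (conj sV sE).
pose Z u := if u \in verts T' then X u else 0.
have Zprod0 (e : {set U}) v : e \in edges T -> e \notin edges T' -> v \in e ->
    \prod_(u in e :\ v) Z u = 0.
  move=> eT eT' ve.
  have ek : #|e :\ v| = k.-1.
    by have := edges_card eT; rewrite (cardsD1 v) ve => <-.
  (* As [k >= 3], [e :\ v] has two distinct elements, and by [meet] they cannot both lie in [T']. *)
  have [/subsetP sub|/subsetPn[u uev uT']] := boolP (e :\ v \subset verts T').
    have : (1 < #|e :\ v|)%N by lia.
    case/card_gt1P=> x [y [xe ye]]; case/eqP.
    by move: (xe) (ye) => /setD1P[_ x'] /setD1P[_ y']; apply: (meet e); rewrite ?sub.
  by rewrite (big_setD1 u) //= /Z (negbTE uT') mul0r.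
exists Z; split.
  have [/set0Pn[v vT'] _] := cT'.
  by exists v; rewrite ?(subsetP sV) // /Z vT' X0.
move=> v vT; rewrite (bigID (mem (edges T'))) /= [X in _ = _ + X]big1 ?addr0; last first.
  by move=> e /andP[/andP[eT ve] eT']; rewrite Zprod0 ?mulr0.
have [vT'|vT'] := boolP (v \in verts T'); last first.
  rewrite big1 => [|e /andP[/andP[_ ve] eT']].
    by rewrite /Z (negbTE vT') expr0n; case: eqP => [|_]; [lia | rewrite mulr0].
  by case/negP: vT'; apply: (subsetP (edges_verts eT')).
apply: (mulIf (X0 v vT')); rewrite mulr_suml /Z vT' -mulrA -exprSr prednK //.
(* (C1) distributes the left side over the edges of [T'] at [v], where the edge relation identifies
   each share. *)
rewrite -[LHS]mulr1 -[X in _ * X = _](C1 v vT') mulr_sumr.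
apply: eq_big => [e|e /andP[eT' ve]].
  by case: (boolP (e \in edges T')) => [/(subsetP sE)->|]; rewrite ?andbT ?andbF.
rewrite [_ * X v ^+ k]mulrC -!mulrA XE // (big_setD1 v) //= [X v * _]mulrC.
congr (_ * (_ * _)); apply: eq_bigr => u /setD1P[_ ue].
by rewrite (subsetP (edges_verts eT')).
Qed.

Theorem theorem3p4 (R : realType) (U : finType) (k : nat) (T : kgraph U k)
    (w : weighting R[i] U) (lam : R[i])
    (hk : (3 <= k)%N) (hT : ktree T)
    (hw : forall e, e \in edges T -> w (inr e) != 0)
    (hlam : forall v, v \in verts T -> lam != w (inl v)) :
  tensor_eigenvalue (adjacency_tensor T w) lam <->
  exists T' : kgraph U k, subtree T' T /\ consistently_normal T' w lam.
Proof.
rewrite tensor_eigenvalueP; last exact: ltnW.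
split=> [[X]|[T' [sT']]]; last exact: normal_eigenfunction.
by apply: eigenfunction_normal => //; exact: ltnW (ltnW hk).
Qed.
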